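(* Let $G$ be a graph of diameter $d$ and let $\ell$ be an integer with $1\leq\ell\leq d$. Then $G$ is $\ell$-distance-balanced if and only if $$\sum_{k=1}^{d-1}|N_k(a)\setminus N_{k-1}[b]|=\sum_{k=1}^{d-1}|N_k(b)\setminus N_{k-1}[a]|$$ holds for all $a,b\in V(G)$ with $d(a,b)=\ell$.
   Context: All graphs are finite, simple, undirected and connected. $d(x,y)$ denotes the geodesic distance in $G$; the diameter is the maximum distance between pairs of vertices. For a non-negative integer $k$ and a vertex $x$, $N_k(x)=\{y: d(x,y)=k\}$ and $N_k[x]=\{y: d(x,y)\leq k\}$. For vertices $u,v$ of $G$, $W_{uv}=\{w\in V(G): d(w,u)<d(w,v)\}$. For a positive integer $\ell$, a graph $G$ of diameter at least $\ell$ is $\ell$-distance-balanced if $|W_{uv}|=|W_{vu}|$ for all $u,v\in V(G)$ with $d(u,v)=\ell$. *)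

(* Defs.v *)
From mathcomp Require Import all_boot.

Set Implicit Arguments.
Unset Strict Implicit.
Unset Printing Implicit Defensive.

Record cgraph := CGraph {
  vertex :> finType;
  adj : rel vertex;
  adj_sym : symmetric adj;
  adj_irr : irreflexive adj;
  adj_connected : forall x y : vertex, connect adj x y
}.

Section Distance.

Variable G : cgraph.
Implicit Types (x y u v : G) (k l n : nat).

Definition walk x y n : bool :=
  [exists p : n.-tuple G, path (@adj G) x p && (last x p == y)].

Lemma walk_exists x y : exists n, walk x y n.
Proof.
have /connectP [p px ->] := adj_connected x y.
by exists (size p); apply/existsP; exists (in_tuple p); rewrite px eqxx.
Qed.

Definition dist x y : nat := ex_minn (walk_exists x y).

Definition diameter : nat := \max_(x : G) \max_(y : G) dist x y.

Definition sphere k x : {set G} := [set y | dist x y == k].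

Definition ball k x : {set G} := [set y | dist x y <= k].

Definition closer u v : {set G} := [set w | dist w u < dist w v].

(* Only meaningful for 0 < l <= diameter; outside this range the condition
   either concerns u = v or is vacuous. *)
Definition distance_balanced l : Prop :=
  forall u v, dist u v = l -> #|closer u v| = #|closer v u|.

End Distance.

Arguments diameter : clear implicits.
Arguments distance_balanced : clear implicits.

(* Main.v *)
Require Import Defs.
From mathcomp Require Import all_boot.

(** A vertex [y] lies in [N_k(a)] but not in [N_(k-1)[b]] exactly when
    [d(a,y) = k <= d(b,y)].  Hence the sum over [1 <= k <= d-1] counts the
    vertices that are no farther from [a] than from [b], except those at
    distance [0] or [d] from [a].  When [a] and [b] are distinct, distance [0]
    leaves out the single vertex [a], and distance [d], the largest possible,
    leaves out the vertices at distance [d] from both.  The vertices no farther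
    from [a] are those of [W_ab] together with the vertices equidistant from
    [a] and [b].  Altogether
    [[
      sum(a, b) + 1 + |N_d(a) n N_d(b)| = |W_ab| + |equidistant vertices|
    ]]
    ([card_closer_sphereD]).  Besides [sum(a, b)] and [|W_ab|], every term of
    this identity is symmetric in [a] and [b]; so the sums for [(a, b)] and
    [(b, a)] agree if and only if [|W_ab| = |W_ba|]. *)

Lemma walk_sym {G : cgraph} (x y : G) n : walk x y n -> walk y x n.
Proof.
case/existsP=> p /andP[px /eqP <-]; apply/existsP.
have szp : size (rev (belast x p)) == n by rewrite size_rev size_belast size_tuple.
exists (Tuple szp) => /=; apply/andP; split.
  rewrite rev_path; apply: sub_path px => u v /=.
  by rewrite adj_sym.
case: {px szp} (tval p) => //= z s.
by rewrite rev_cons last_rcons.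
Qed.

Lemma dist_sym {G : cgraph} (x y : G) : dist x y = dist y x.
Proof.
have le_dist u v : dist u v <= dist v u.
  rewrite /dist; case: ex_minnP => m _; apply.
  by case: ex_minnP => k /walk_sym.
by apply/eqP; rewrite eqn_leq !le_dist.
Qed.

Lemma dist_eq0 {G : cgraph} (x y : G) : (dist x y == 0) = (x == y).
Proof.
rewrite /dist; case: ex_minnP => n w_n min_n; apply/eqP/eqP => [n0 | xy].
  move: w_n; rewrite n0 => /existsP[p /andP[_ /eqP <-]].
  by rewrite tuple0.
apply/eqP; rewrite -leqn0; apply: min_n; apply/existsP.
by exists [tuple]; rewrite /= xy.
Qed.

Lemma dist_le_diameter {G : cgraph} (x y : G) : dist x y <= diameter G.
Proof.
apply: leq_trans (leq_bigmax x).
exact: (leq_bigmax (F := fun z => dist x z) y).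
Qed.

(** Fibring over the distance to [a]: each vertex no farther from [a] than from
    [b] lies on exactly one sphere about [a], of radius at most the diameter. *)
Lemma card_not_farther {G : cgraph} (a b : G) :
  #|[set y | dist a y <= dist b y]| =
  \sum_(0 <= k < (diameter G).+1) #|[set y | dist a y == k & k <= dist b y]|.
Proof.
rewrite big_mkord -sum1_card.
rewrite (partition_big (fun y => inord (dist a y)) (mem 'I_(diameter G).+1)) //=.
apply: eq_bigr => k _; rewrite -sum1_card; apply: eq_bigl => y.
rewrite !inE -val_eqE /= inordK ?ltnS ?dist_le_diameter //.
by rewrite andbC; case: eqP => // ->.
Qed.

Lemma card_not_farther_closer {G : cgraph} (a b : G) :
  #|[set y | dist a y <= dist b y]| =
  #|closer a b| + #|[set y | dist a y == dist b y]|.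
Proof.
rewrite -cardsUI; set I := _ :&: _.
have -> : I = set0.
  apply/setP=> y; rewrite !inE (dist_sym y a) (dist_sym y b).
  by case: ltngtP.
rewrite cards0 addn0; apply: eq_card => y.
by rewrite !inE (dist_sym y a) (dist_sym y b) leq_eqVlt orbC.
Qed.

(** The two terms added to the sum on the left are what the spheres about [a]
    of radius [0] and of radius the diameter contribute to the set of vertices
    no farther from [a] than from [b]. *)
Lemma card_closer_sphereD {G : cgraph} (a b : G) :
  0 < diameter G -> a != b ->
  \sum_(1 <= k < diameter G) #|sphere k a :\: ball k.-1 b|
    + (1 + #|sphere (diameter G) a :&: sphere (diameter G) b|) =
  #|closer a b| + #|[set y | dist a y == dist b y]|.
Proof.
move=> d_gt0 neq_ab.
rewrite -card_not_farther_closer card_not_farther.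
rewrite [RHS]big_ltn // [\sum_(1 <= k < _.+1) _]big_nat_recr //= addnCA.
congr (_ + (_ + _)).
- rewrite -(cards1 a); apply: eq_card => y.
  by rewrite !inE dist_eq0 andbT eq_sym.
- apply: eq_big_nat => k /andP[k_gt0 _]; apply: eq_card => y.
  by rewrite !inE -ltnNge prednK // andbC.
- apply: eq_card => y; rewrite !inE; congr (_ && _).
  by rewrite eqn_leq dist_le_diameter.
Qed.

Theorem proposition6p1 (G : cgraph) (d : nat) (hd : diameter G = d)
    (l : nat) (hl : 1 <= l <= d) :
  distance_balanced G l <->
  (forall a b : G, dist a b = l ->
     \sum_(1 <= k < d) #|sphere k a :\: ball k.-1 b| =
     \sum_(1 <= k < d) #|sphere k b :\: ball k.-1 a|).
Proof.
case/andP: hl => l_gt0 le_ld; subst d.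
have d_gt0 := leq_trans l_gt0 le_ld.
have eq_iff (a b : G) : dist a b = l ->
  #|closer a b| = #|closer b a| <->
  \sum_(1 <= k < diameter G) #|sphere k a :\: ball k.-1 b| =
  \sum_(1 <= k < diameter G) #|sphere k b :\: ball k.-1 a|.
  move=> ab_l; have neq_ab : a != b by rewrite -dist_eq0 ab_l -lt0n.
  have Eab := card_closer_sphereD _ _ d_gt0 neq_ab.
  have neq_ba : b != a by rewrite eq_sym.
  have := card_closer_sphereD _ _ d_gt0 neq_ba; rewrite setIC.
  have -> : [set y | dist b y == dist a y] = [set y | dist a y == dist b y].
    by apply/setP=> y; rewrite !inE eq_sym.
  move=> Eba; split=> E.
    by apply/eqP; move/eqP: Eab; rewrite E -Eba eqn_add2r.
  by apply/eqP; move/eqP: Eab; rewrite E Eba eqn_add2r eq_sym.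
by split=> H a b ab_l; apply/(eq_iff a b ab_l); apply: H.
Qed.
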